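(* In a finite dynamic game as described in the context, let $K=(K^i)_{i\in\mathcal{I}}$ be compressed information generated by fixed update maps. If $K$ is mutually sufficient information, then there exists at least one $K$-based Bayes–Nash equilibrium, i.e. a profile $\rho=(\rho^i)_{i\in\mathcal{I}}$ of $K^i$-based strategies such that for every player $i$ and every (full-history) behavioral strategy $\tilde g^i$ of player $i$, $J^i(\rho)\ge J^i(\tilde g^i,\rho^{-i})$.
   Context: Game model: finite set of players $\mathcal{I}$, times $\mathcal{T}=\{1,\dots,T\}$. At time $t$ each player $i$ takes action $U_t^i\in\mathcal{U}_t^i$, obtains reward $R_t^i\in[-1,1]$ and learns new information $Z_t^i\in\mathcal{Z}_t^i$. There is a state $X_t\in\mathcal{X}_t$ with $(X_{t+1},Z_t,R_t)=f_t(X_t,U_t,W_t)$ for fixed functions $f_t$, where $U_t=(U_t^i)_i$, $Z_t=(Z_t^i)_i$, $R_t=(R_t^i)_i$. The primitive random variables are $(X_1,H_1)$ (with $H_1=(H_1^i)_i$ the initial information, possibly correlated with $X_1$) and $W_1,\dots,W_T$; the vector $(X_1,H_1)$ and $W_1,\dots,W_T$ are mutually independent with commonly known distributions. All sets $\mathcal{X}_t,\mathcal{U}_t,\mathcal{Z}_t,\mathcal{W}_t,\mathcal{H}_1$ are finite. Perfect recall: player $i$'s information at time $t$ is $H_t^i=(H_1^i,Z_{1:t-1}^i)\in\mathcal{H}_t^i$, and $U_t^i$ is a component of $Z_t^i$. A behavioral strategy $g^i=(g_t^i)_t$ has $g_t^i:\mathcal{H}_t^i\to\Delta(\mathcal{U}_t^i)$;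 payoff $J^i(g)=\mathbb{E}^g[\sum_{t=1}^T R_t^i]$. $\Pr^g,\mathbb{E}^g$ denote probability/expectation under profile $g$. A realization is admissible under a partially specified profile (e.g. $g^{-i}$) if it has positive probability under some completion of that profile. Compression: for each $i$, $K_1^i=\iota_1^i(H_1^i)$, $K_t^i=\iota_t^i(K_{t-1}^i,Z_{t-1}^i)$ for fixed maps $\iota_t^i$, with values in finite sets $\mathcal{K}_t^i$; $k_t^i$ denotes the compression of $h_t^i$. A $K^i$-based strategy is $\rho^i=(\rho_t^i)_t$ with $\rho_t^i:\mathcal{K}_t^i\to\Delta(\mathcal{U}_t^i)$; a $K$-based profile has every player using a $K^i$-based strategy. Information state: given $g^{-i}$, $K^i$ is an information state under $g^{-i}$ if there exist functions $P_t^{i,g^{-i}}:\mathcal{K}_t^i\times\mathcal{U}_t^i\to\Delta(\mathcal{K}_{t+1}^i)$ and $r_t^{i,g^{-i}}:\mathcal{K}_t^i\times\mathcal{U}_t^i\to[-1,1]$ (not depending on $g^i$) with $\Pr^{g^i,g^{-i}}(k_{t+1}^i\mid h_t^i,u_t^i)=P_t^{i,g^{-i}}(k_{t+1}^i\mid k_t^i,u_t^i)$ for $t<T$ and $\mathbb{E}^{g^i,g^{-i}}[R_t^i\mid h_t^i,u_t^i]=r_t^{i,g^{-i}}(k_t^i,u_t^i)$ for all $t$, for all $g^i$ and all $(h_t^i,u_t^i)$ admissible under $(g^i,g^{-i})$. Mutually sufficient information (MSI): $K$ is MSI if for every player $i$ and every profile $\rho^{-i}$ of $K^{j}$-based strategies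 of the players $j\ne i$, $K^i$ is an information state under $\rho^{-i}$. *)

(* Defs.v *)
From HB Require Import structures.
From mathcomp Require Import all_boot all_order all_algebra.
From mathcomp Require Import reals.
Unset Printing Implicit Defensive.
Import Order.TTheory GRing.Theory Num.Theory.
Local Open Scope ring_scope.

Record dist (R : realType) (A : finType) := Dist {
  pmf :> {ffun A -> R};
  _ : [forall a, 0 <= pmf a] && (\sum_a pmf a == 1) }.

(* Game data. Times are 0-indexed: t = 0,...,T-1 stands for 1,...,T.
   X t is the state space at time t (X T is the terminal state space). *)
Record game (R : realType) := Game {
  Pl : finType;
  T : nat;
  X : nat -> finType;
  U : nat -> Pl -> finType;                      (* actions *)
  Z : nat -> Pl -> finType;                      (* new information *)
  W : nat -> finType;                            (* noise *)
  H1 : Pl -> finType;                            (* initial information *)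
  (* (X_{t+1}, Z_t, R_t) = f_t(X_t, U_t, W_t) *)
  f : forall t, X t -> {dffun forall i, U t i} -> W t ->
        (X t.+1 * {dffun forall i, Z t i} * {ffun Pl -> R});
  (* joint law of (X_1, H_1), and laws of the W_t (mutually independent) *)
  P0 : dist R (X 0 * {dffun forall i, H1 i})%type;
  PW : forall t, dist R (W t)
}.

Arguments Pl {R}. Arguments T {R}. Arguments X {R}. Arguments U {R}.
Arguments Z {R}. Arguments W {R}. Arguments H1 {R}. Arguments f {R}.
Arguments P0 {R}. Arguments PW {R}.



Section Game.
Variable R : realType.
Variable G : game R.

Local Notation I := (Pl G).

Definition rewards_bounded : Prop :=
  forall t, (t < T G)%N -> forall x u w (i : I),
    -1 <= (f G t x u w).2 i <= 1.

Definition actions_recalled : Prop :=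
  forall t, (t < T G)%N -> forall i : I, exists proj : Z G t i -> U G t i,
    forall x u w, proj ((f G t x u w).1.2 i) = u i.

(* Action sets are nonempty (implicit in the paper: Delta(U_t^i) must be
   nonempty).  Stated for every index t, since U t i for t >= T is junk data
   outside the model (any model extends to such indices). *)
Definition actions_nonempty : Prop :=
  forall t (i : I), exists a : U G t i, True.

Fixpoint hist (i : I) (t : nat) : finType :=
  match t with
  | 0 => H1 G i
  | t'.+1 => (hist i t' * Z G t' i)%type
  end.

Definition strat (i : I) := forall t, hist i t -> dist R (U G t i).
Definition profile := forall i : I, strat i.

Section Prob.
Variable g : profile.

Fixpoint mu (t : nat) : X G t -> {dffun forall j, hist j t} -> R :=
  match t as n return X G n -> {dffun forall j, hist j n} -> R with
  | 0 => fun x h => P0 G (x, h)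
  | t'.+1 => fun x' h' =>
      \sum_(x : X G t') \sum_(h : {dffun forall j, hist j t'})
      \sum_(u : {dffun forall j, U G t' j}) \sum_(w : W G t')
        (if ((f G t' x u w).1.1 == x') &&
            [forall j, h' j == ((h j, (f G t' x u w).1.2 j) : hist j t'.+1)]
         then mu t' x h * (\prod_j g j t' (h j) (u j)) * PW G t' w else 0)
  end.

Definition weight t x (h : {dffun forall j, hist j t}) (u : {dffun forall j, U G t j}) w :=
  mu t x h * (\prod_j g j t (h j) (u j)) * PW G t w.

Definition Pr_hu (i : I) t (hh : hist i t) (uu : U G t i) : R :=
  \sum_(x : X G t) \sum_(h : {dffun forall j, hist j t})
  \sum_(u : {dffun forall j, U G t j}) \sum_(w : W G t)
    (if (h i == hh) && (u i == uu) then weight t x h u w else 0).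
End Prob.

Record compression := Compression {
  K : nat -> I -> finType;
  iota1 : forall i, H1 G i -> K 0 i;
  iotaS : forall t i, K t i -> Z G t i -> K t.+1 i
}.

Section Compr.
Variable C : compression.

Fixpoint kof (i : I) (t : nat) : hist i t -> K C t i :=
  match t as n return hist i n -> K C n i with
  | 0 => fun h => iota1 C i h
  | t'.+1 => fun h => iotaS C t' i (kof i t' h.1) h.2
  end.

Definition kstrat (i : I) := forall t, K C t i -> dist R (U G t i).
Definition kprofile := forall i : I, kstrat i.

Definition kstrat_beh (i : I) (rho : kstrat i) : strat i :=
  fun t h => rho t (kof i t h).

Definition kprofile_beh (rho : kprofile) : profile :=
  fun i => kstrat_beh i (rho i).


Definition Pr_huk (g : profile) (i : I) t (hh : hist i t) (uu : U G t i) (k' : K C t.+1 i) : R :=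
  \sum_(x : X G t) \sum_(h : {dffun forall j, hist j t})
  \sum_(u : {dffun forall j, U G t j}) \sum_(w : W G t)
    (if [&& h i == hh, u i == uu & iotaS C t i (kof i t hh) ((f G t x u w).1.2 i) == k']
     then weight g t x h u w else 0).

Definition ER_hu (g : profile) (i : I) t (hh : hist i t) (uu : U G t i) : R :=
  \sum_(x : X G t) \sum_(h : {dffun forall j, hist j t})
  \sum_(u : {dffun forall j, U G t j}) \sum_(w : W G t)
    (if (h i == hh) && (u i == uu)
     then weight g t x h u w * (f G t x u w).2 i else 0).

Definition info_state (g : profile) (i : I) : Prop :=
  (* only g^{-i} matters: the i-th component of g is overridden by gi *)
  exists (P : forall t, K C t i -> U G t i -> dist R (K C t.+1 i))
         (r : forall t, K C t i -> U G t i -> R),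
    (forall t k a, -1 <= r t k a <= 1) /\
    forall gi : strat i, let gg := dfwith g gi in
    forall t, (t < T G)%N -> forall (hh : hist i t) (uu : U G t i),
      0 < Pr_hu gg i t hh uu ->
      (forall k' : K C t.+1 i, (t.+1 < T G)%N ->
         Pr_huk gg i t hh uu k' / Pr_hu gg i t hh uu = P t (kof i t hh) uu k') /\
      ER_hu gg i t hh uu / Pr_hu gg i t hh uu = r t (kof i t hh) uu.

Definition MSI : Prop :=
  forall (i : I) (rho : kprofile), info_state (kprofile_beh rho) i.

End Compr.

Definition payoff (g : profile) (i : I) : R :=
  \sum_(t < T G) \sum_(x : X G t) \sum_(h : {dffun forall j, hist j t})
  \sum_(u : {dffun forall j, U G t j}) \sum_(w : W G t) weight g t x h u w * (f G t x u w).2 i.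

Definition K_BNE (C : compression) (rho : kprofile C) : Prop :=
  forall (i : I) (gi : strat i),
    payoff (dfwith (kprofile_beh C rho) gi) i <= payoff (kprofile_beh C rho) i.

End Game.

Arguments rewards_bounded {R}. Arguments actions_recalled {R}.
Arguments actions_nonempty {R}. Arguments hist {R}. Arguments strat {R}.
Arguments profile {R}. Arguments mu {R}. Arguments weight {R}. Arguments Pr_hu {R}.
Arguments compression {R}. Arguments K {R G}. Arguments iota1 {R G}. Arguments iotaS {R G}.
Arguments kof {R G}. Arguments kstrat {R G}. Arguments kprofile {R G}.
Arguments kstrat_beh {R G}. Arguments kprofile_beh {R G}. Arguments Pr_huk {R G}.
Arguments ER_hu {R G}. Arguments info_state {R G}. Arguments MSI {R G}.
Arguments payoff {R}. Arguments K_BNE {R G}.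

(* Main.v *)
Require Import Defs.
From mathcomp Require Import boolp classical_sets topology normedtype.
From mathcomp Require Import all_boot all_order all_algebra reals zify lra.

(* Fix trembles of size 1/(n+1) and treat every triple (player i, time t,
   compressed information k) as a separate agent.  By Brouwer's theorem (proved
   from Scarf's combinatorial lemma) Nash's improvement map has a fixed point,
   at which no agent gains by a one-shot deviation.  Mutual sufficiency turns
   the problem of player i into a Markov decision process on K^i against any
   full-history strategy, and the performance difference formula
     J(g) - J(rho) = sum_t E^g [Q_t(K_t, U_t) - V_t(K_t)]
   expresses payoffs through the Q- and V-functions of rho.  Since trembles make
   every reachable k have positive probability, the absence of one-shot gains
   bounds each Q - V by 2T/(n+1), so the profile is a 2T^2/(n+1)-equilibrium
   among all full-history deviations; compactness lets n go to infinity. *)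

Set Implicit Arguments.
Unset Strict Implicit.
Import Order.TTheory GRing.Theory Num.Theory numFieldNormedType.Exports.
Unset Printing Implicit Defensive.

(** * Scarf's lemma *)

Section Scarf.
Variables (V I : finType) (rk : I -> V -> nat).
Hypothesis rk_inj : forall i, injective (rk i).
Implicit Types (s : {set V}) (i j k a b : I) (t u v w : V).

(** Scarf's dominance: no point beats the minimum of [s] in all the orders [rk i] at once. *)
Definition dominant s :=
  [forall t, [exists i, [forall v in s, rk i t <= rk i v]]].

Lemma dominantP s :
  reflect (forall t, exists i, forall v, v \in s -> rk i t <= rk i v)
          (dominant s).
Proof.
apply: (iffP forallP) => h t; have := h t.
  by case/existsP=> i /forall_inP; exists i.
by case=> i hi; apply/existsP; exists i; apply/forall_inP.
Qed.

Lemma dominant_sub s s' : s \subset s' -> dominant s' -> dominant s.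
Proof.
move=> /subsetP ss' /dominantP h; apply/dominantP => t.
by have [i hi] := h t; exists i => v /ss'; apply: hi.
Qed.

(* Exactly two indices a, b have the same minimiser over s.  For k = a or b the
   rk k-largest point lying above the minima of all other indices extends s,
   and nothing else does. *)
Lemma card_dominant_extensions s :
  s != set0 -> dominant s -> #|s|.+1 = #|I| ->
  (forall k, exists t, forall i, i != k -> exists2 v, v \in s & rk i v < rk i t) ->
  #|[set v | (v \notin s) && dominant (v |: s)]| = 2.
Proof.
case/set0Pn=> v0 v0s doms cards Mn0.
pose m i := [arg min_(v < v0 | v \in s) rk i v].
have ms i : m i \in s by rewrite /m; case: arg_minnP.
have mle i v : v \in s -> rk i (m i) <= rk i v.
  by rewrite /m; case: arg_minnP => // w _ h /h.
(* Dominance applied to a point of [s] itself makes that point the minimiser of some index. With one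
   index more than points, two indices then share a minimiser. *)
have m_img : m @: [set: I] = s.
  apply/setP=> v; apply/imsetP/idP => [[i _ ->]//|vs].
  have [i hi] := dominantP _ doms v; exists i => //.
  by apply: (rk_inj (i := i)); apply/eqP; rewrite eqn_leq hi //= mle.
have [a [b [ab mab]]] : exists a b, a != b /\ m a = m b.
  have : ~~ injectiveb m.
    apply/negP => /injectiveP minj.
    by have := card_imset [set: I] minj; rewrite m_img cardsT; lia.
  by case/injectivePn => a [b ab mab]; exists a, b.
have other k : k \in [:: a; b] -> exists2 k', k' != k & m k' = m k.
  by rewrite !inE => /orP[]/eqP->; [exists b; rewrite // eq_sym | exists a].
have minj k : m @: [set~ k] = s -> {in [set~ k] &, injective m}.
  by move=> h; apply/imset_injP; rewrite h cardsC1 -cards.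
have m_imgC k : k \in [:: a; b] -> m @: [set~ k] = s.
  move=> /other[k' k'k mk']; apply/setP=> v; apply/imsetP/idP => [[i _ ->]//|].
  rewrite -m_img => /imsetP[i _ ->]; have [->|ik] := eqVneq i k.
    by exists k'; rewrite ?inE ?mk'.
  by exists i; rewrite ?inE.
pose M k := [set t | [forall i, (i != k) ==> (rk i (m i) < rk i t)]].
have MP k t : reflect (forall i, i != k -> rk i (m i) < rk i t) (t \in M k).
  rewrite inE; apply: (iffP forallP) => h i; first exact: implyP (h i).
  by apply/implyP; apply: h.
have {}Mn0 k : exists t, t \in M k.
  have [t ht] := Mn0 k; exists t; apply/MP => i /ht[v vs].
  by apply: leq_ltn_trans; apply: mle.
pose top k := [arg max_(t > xchoose (Mn0 k) | t \in M k) rk k t].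
have topM k : top k \in M k by rewrite /top; case: arg_maxnP => //; apply: xchooseP.
have le_top k t : t \in M k -> rk k t <= rk k (top k).
  by rewrite /top; case: arg_maxnP => [|w _ h /h//]; apply: xchooseP.
(* A point above the minima of all indices but [k] can satisfy dominance only through [k]. *)
have M_dom k t : t \in M k -> forall v, v \in s -> rk k t <= rk k v.
  move=> /MP tM; have [i hi] := dominantP _ doms t.
  have [<-//|ik] := eqVneq i k.
  by have := tM i ik; rewrite ltnNge hi.
have ext_top k : k \in [:: a; b] ->
    (top k \notin s) && dominant (top k |: s).
  move=> kab; have [k' k'k mk'] := other k kab; have /MP tM := topM k.
  apply/andP; split.
    apply/negP; rewrite -(m_imgC k kab) => /imsetP[i]; rewrite !inE => ik e.
    by have := tM i ik; rewrite e ltnn.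
  apply/dominantP => t; have [tMk|] := boolP (t \in M k).
    exists k => v; rewrite in_setU1 => /predU1P[->|]; first exact: le_top.
    exact: M_dom.
  rewrite inE negb_forall => /existsP[i]; rewrite negb_imply -leqNgt.
  case/andP => ik it; exists i => v; rewrite in_setU1 => /predU1P[->|vs].
    by apply: leq_trans it (ltnW _); apply: tM.
  by apply: leq_trans it _; apply: mle.
have top_ab : top a != top b.
  apply/eqP => tab; have [i hi] := dominantP _ doms (top a).
  have [ia|ia] := eqVneq i a.
    subst i; have /MP/(_ a ab) := topM b.
    by rewrite -tab ltnNge hi.
  by have /MP/(_ i ia) := topM a; rewrite ltnNge hi.
suff -> : [set v | (v \notin s) && dominant (v |: s)] = [set top a; top b].
  by rewrite cards2 top_ab.
apply/setP=> w; rewrite in_set in_set2; apply/idP/idP; last first.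
  by case/orP=> /eqP->; apply: ext_top; rewrite !inE eqxx ?orbT.
case/andP=> ws /dominantP domw.
(* Dominance at [w] itself gives an index [k] for which [w] is least, so the minimisers of the other
   indices already exhaust [s]. By cardinality [m] is injective on these indices, which forces [k]
   to be [a] or [b]. *)
have [k hk] := domw w.
have wk v : v \in s -> exists2 i, i != k & m i = v /\ rk i v <= rk i w.
  move=> vs; have [i hi] := domw v; exists i.
    apply/eqP => ik; case/negP: ws.
    suff -> : w = v by [].
    apply: (rk_inj (i := i)); apply/eqP; rewrite eqn_leq hi ?setU11 // andbT.
    by rewrite ik hk // setU1r.
  split; last by rewrite hi ?setU11.
  apply: (rk_inj (i := i)); apply/eqP.
  by rewrite eqn_leq mle //= hi // setU1r.
have imgk : m @: [set~ k] = s.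
  apply/setP=> v; apply/imsetP/idP => [[i _ ->]//|/wk[i ik [<- _]]].
  by exists i; rewrite ?inE.
have kab : k \in [:: a; b].
  apply/negPn; rewrite !inE negb_or; apply/negP => /andP[ka kb].
  case/eqP: ab; apply: (minj k imgk) => //; rewrite !inE eq_sym //.
have wM : w \in M k.
  apply/MP => i ik; have [j jk [mj le]] := wk _ (ms i).
  have ji : j = i by apply: (minj k imgk) => //; rewrite !inE.
  subst j; rewrite ltn_neqAle le andbT.
  by apply/eqP => /rk_inj e; case/negP: ws; rewrite -e.
have -> : w = top k.
  apply: (rk_inj (i := k)); apply/eqP; rewrite eqn_leq le_top //=.
  have [i hi] := domw (top k).
  have [ik|ik] := eqVneq i k; first by subst i; rewrite hi ?setU11.
  by have /MP/(_ i ik) := topM k; rewrite ltnNge hi // setU1r.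
by move: kab; rewrite !inE => /orP[]/eqP->; rewrite eqxx ?orbT.
Qed.

(** * Sperner parity: doors, rooms and their incidences *)

Section Parity.
Variables (c : V -> I) (i0 : I).

Let door s := c @: s == [set~ i0].

(* Sperner's parity argument: a set of #|I| points has one door if c maps it
   onto I, and zero or two doors otherwise. *)
Lemma odd_doors s : #|s| = #|I| ->
  odd #|[set v in s | door (s :\ v)]| = (c @: s == [set: I]).
Proof.
move=> cards; have [cs|ncs] := eqVneq (c @: s) [set: I].
  have cinj : {in s &, injective c}.
    by apply/imset_injP; rewrite cs cardsT cards.
  have /imsetP[v vs cv] : i0 \in c @: s by rewrite cs inE.
  suff -> : [set v in s | door (s :\ v)] = [set v] by rewrite cards1.
  apply/setP=> w; rewrite !inE; apply/andP/eqP => [[ws /eqP dw]|->].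
    apply/eqP; apply: contraT; rewrite eq_sym => vw.
    have : c v \in c @: (s :\ w) by apply: imset_f; rewrite !inE vw.
    by rewrite dw !inE cv eqxx.
  split=> //; apply/eqP/setP => i; rewrite !inE; apply/imsetP/idP.
    case=> u; rewrite !inE => /andP[uv us] ->; rewrite cv.
    by apply: contra uv => /eqP/cinj->.
  have : i \in c @: s by rewrite cs inE.
  case/imsetP=> u us -> cu; exists u; rewrite // !inE us andbT.
  by apply: contra cu => /eqP->; rewrite cv.
have [->|/set0Pn[v]] := eqVneq [set v in s | door (s :\ v)] set0.
  by rewrite cards0.
rewrite inE => /andP[vs /eqP dv].
have cinj : {in s :\ v &, injective c}.
  apply/imset_injP; rewrite dv cardsC1.
  by have := cardsD1 v s; rewrite vs cards => ->.
have cv : c v != i0.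
  apply/eqP => cv; case/eqP: ncs; apply/setP=> i; rewrite inE.
  have [->|ii0] := eqVneq i i0; first by rewrite -cv imset_f.
  have : i \in c @: (s :\ v) by rewrite dv !inE.
  by apply/subsetP/imsetS/subD1set.
(* [v'] is the one other point sharing the colour of [v]: removing either keeps the image, removing
   any third point loses a colour. *)
have /imsetP[v'] : c v \in c @: (s :\ v) by rewrite dv !inE.
rewrite !inE => /andP[v'v v's] cvv'.
suff -> : [set v in s | door (s :\ v)] = [set v; v'].
  by rewrite cards2 eq_sym v'v.
apply/setP=> w; rewrite !inE; apply/andP/orP => [[ws /eqP dw]|].
  apply/orP; apply: contraT; rewrite negb_or => /andP[wv wv'].
  have : c w \in c @: (s :\ w).
    by rewrite dw -dv imset_f // !inE wv.
  case/imsetP=> u; rewrite !inE => /andP[uw us] cwu.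
  have [uv|uv] := eqVneq u v.
    case/eqP: wv'; apply: cinj; rewrite ?inE ?wv ?v'v //.
    by rewrite cwu uv.
  by case/eqP: uw; apply: cinj; rewrite ?inE ?wv ?uv.
case=> /eqP->; split=> //; first exact/eqP.
rewrite /door -dv; apply/eqP/setP => i; apply/imsetP/imsetP.
  case=> u; rewrite !inE => /andP[uv' us] ->.
  have [->|uv] := eqVneq u v; first by exists v'; rewrite // !inE v'v.
  by exists u; rewrite // !inE uv.
case=> u; rewrite !inE => /andP[uv us] ->.
have [->|uv'] := eqVneq u v'; first by exists v; rewrite // !inE eq_sym v'v.
by exists u; rewrite // !inE uv'.
Qed.

(** Both sides count pairs of a door and a room that extends it by one point, first by doors, then
    by rooms. *)
Lemma double_count_doors (room : pred {set V}) :
  \sum_(s | door s) #|[set v | (v \notin s) && room (v |: s)]| =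
  \sum_(s | room s) #|[set v in s | door (s :\ v)]|.
Proof.
under eq_bigr do rewrite -sum1dep_card big_mkcond.
under [RHS]eq_bigr do rewrite -sum1dep_card big_mkcond.
rewrite exchange_big [RHS]exchange_big; apply: eq_bigr => v _ /=.
rewrite -!big_mkcondr.
rewrite (reindex_onto (fun s => s :\ v) (fun s => v |: s)) /=; last first.
  by move=> s /and3P[_ vs _]; rewrite setU1K.
apply: eq_bigl => s; rewrite setD11 /= andbC.
have [vs|vs] := boolP (v \in s).
  by rewrite setD1K // eqxx /= andbC.
rewrite /= andbF; apply/negbTE; rewrite negb_and; apply/orP; left.
by apply: contra vs => /eqP <-; rewrite setU11.
Qed.

End Parity.

End Scarf.

(* The extra points inr i play the role of slack vectors: inr i is the least
   point for i and lies above all of T for the other indices.  The set of all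
   slacks but inr i0 is the only door with an odd number of extensions. *)
Lemma scarf (T I : finType) (r : I -> T -> nat) (t0 : T) (i0 : I) (c : T -> I) :
  (forall i, injective (r i)) ->
  exists (D : {set T}) (C : {set I}),
    (forall t, exists2 i, i \in C & forall d, d \in D -> r i t <= r i d) /\
    (forall i, i \in C -> exists2 d, d \in D & c d = i).
Proof.
move=> r_inj; pose B i := (\max_t r i t).+2.
have rB i t : (r i t).+1 < B i by rewrite !ltnS (leq_bigmax t).
pose rk i (v : T + I) := match v with
  | inl t => (r i t).+1
  | inr j => if j == i then 0 else B i + enum_rank j end.
have rk_inj i : injective (rk i).
  move=> [t|j] [t'|j'] /=.
  - by case=> /r_inj->.
  - by case: eqP => // _ e; have := rB i t; rewrite e -ltn_subRL subnn.
  - by case: eqP => // _ e; have := rB i t'; rewrite -e -ltn_subRL subnn.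
  - case: eqP => [->|_]; case: eqP => [->|_] //.
    by move/eqP; rewrite eqn_add2l => /eqP/val_inj/enum_rank_inj->.
pose c' (v : T + I) := match v with inl t => c t | inr j => j end.
pose room (s : {set T + I}) := (#|s| == #|I|) && dominant rk s.
have slack i t : ~~ (rk i (inl t) <= rk i (inr i)) by rewrite /= eqxx.
have below i j t : j != i -> rk i (inl t) < rk i (inr j).
  by move=> /negbTE ji; rewrite /= ji (leq_trans (rB i t)) ?leq_addr.
suff [s /andP[/andP[_ /dominantP doms] /eqP cs]] :
    exists s, room s && (c' @: s == [set: I]).
  (* Slack [i] lies below all of [T] for [i], so an index witnessing dominance at an original point
     has its slack outside [s]. The colour of such an index must then come from an original
     point. *)
  exists [set t | inl t \in s], [set i | inr i \notin s]; split=> [t|i].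
    have [i hi] := doms (inl t); exists i.
      by rewrite inE; apply: contra (slack i t); apply: hi.
    by move=> d; rewrite inE => /hi.
  rewrite inE => is_; have : i \in c' @: s by rewrite cs inE.
  case/imsetP => -[d|j] vs /= e; first by exists d; rewrite ?inE.
  by rewrite e vs in is_.
(* Without a fully coloured room the incidence count is even when taken over rooms. Taken over doors
   it is odd, a contradiction. *)
apply/existsP; apply: contraT; rewrite negb_exists => /forallP noroom.
have := congr1 odd (double_count_doors c' i0 room).
rewrite !(big_morph odd oddD (erefl _ : odd 0 = false)).
rewrite [RHS]big1; last first.
  move=> s rs; have := noroom s; rewrite rs /= => /negbTE ncs.
  by rewrite odd_doors //; case/andP: rs => /eqP.
pose s0 : {set T + I} := [set inr i | i in [set~ i0]].
have in_s0 v : v \in s0 = if v is inr j then j != i0 else false.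
  apply/imsetP/idP => [[i]|]; first by rewrite !inE => ii0 ->.
  by case: v => // j ji0; exists j; rewrite ?inE.
have cs0 : c' @: s0 == [set~ i0].
  apply/eqP/setP=> i; apply/imsetP/idP => [[v]|].
    by rewrite in_s0; case: v => //= j ji0 ->; rewrite !inE.
  by rewrite !inE => ii0; exists (inr i); rewrite ?in_s0.
rewrite (bigD1 s0) //= big1 ?addbF => [|s /andP[/eqP cs ss0]].
  (* The only room through the all-slack door adds the original point that is highest for [i0]. *)
  pose tm := [arg max_(t > t0) r i0 t].
  have tmP t : r i0 t <= r i0 tm by rewrite /tm; case: arg_maxnP => // ? _ /(_ t isT).
  suff -> : [set v | (v \notin s0) && room (v |: s0)] = [set inl tm].
    by rewrite cards1.
  apply/setP=> -[d|j]; rewrite !inE in_s0 /=; last first.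
    rewrite negbK [inr j == _]/eq_op /=; apply/negbTE; rewrite !negb_and.
    have [->|//] := eqVneq j i0; do 2 (apply/orP; right).
    apply/negP => /dominantP/(_ (inl t0))[i hi].
    case/negP: (slack i t0); apply: hi; rewrite !inE in_s0.
    by rewrite [_ == _]/eq_op /=; case: eqVneq.
  have -> : room (inl d |: s0) = dominant rk (inl d |: s0).
    rewrite /room cardsU1 in_s0 card_imset => [|i j []//].
    by rewrite cardsC1 add1n prednK ?eqxx //; apply/card_gt0P; exists i0.
  rewrite [inl d == _]/eq_op /=; apply/dominantP/eqP => [h|-> [t|j]].
  - apply: (r_inj i0); apply/eqP; rewrite eqn_leq tmP /=.
    have [i hi] := h (inl tm).
    suff <- : i = i0 by apply: (hi (inl d)); rewrite setU11.
    apply/eqP; apply: contraT => ii0; case/negP: (slack i tm); apply: hi.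
    by rewrite !inE in_s0.
  - exists i0 => -[d'|j]; rewrite !inE in_s0 orbC /=.
      by rewrite /eq_op /= => /eqP->; rewrite ltnS.
    by rewrite /eq_op /= orbF => ji; apply/ltnW/below.
  - by exists j => v _; rewrite /= eqxx.
apply/negbTE; have [sE|/set0Pn[v]] :=
  eqVneq [set v | (v \notin s) && room (v |: s)] set0; first by rewrite sE cards0.
rewrite inE => /andP[vs /andP[card_vs dom_vs]].
have card_s : #|s|.+1 = #|I| by rewrite -(eqP card_vs) cardsU1 vs.
have -> : [set v | (v \notin s) && room (v |: s)] =
          [set v | (v \notin s) && dominant rk (v |: s)].
  apply/setP=> w; rewrite !inE /room cardsU1.
  by have [//|ws] := boolP (w \in s); rewrite add1n card_s eqxx.
(* A door other than [s0] contains an original point, which for every index but [k] lies below the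
   slack [k]. This supplies the points required by [card_dominant_extensions]. *)
have [d ds] : exists d, inl d \in s.
  apply/existsP; apply: contraT; rewrite negb_exists => /forallP sI.
  case/eqP: ss0; apply/setP => -[t|j]; rewrite in_s0; first exact/negbTE.
  have : (j \in c' @: s) = (j != i0) by rewrite cs !inE.
  move=> <-; apply/idP/imsetP => [js|[[t|j'] us ->//]]; first by exists (inr j).
  by have := sI t; rewrite us.
rewrite (card_dominant_extensions rk_inj _ _ card_s) //.
- by apply/set0Pn; exists (inl d).
- exact: dominant_sub (subsetUr _ _) dom_vs.
- by move=> k; exists (inr k) => i ik; exists (inl d) => //; apply: below; rewrite eq_sym.
Qed.

(* Points of the simplex are compared by each coordinate, ties being broken by
   the enumeration of the points. *)
Lemma grid_sperner (I : finType) (N : nat) (i0 : I)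
    (c : {ffun I -> 'I_N.+1} -> I) :
  exists d : I -> {ffun I -> 'I_N.+1},
    [/\ forall i, \sum_l d i l = N,
        forall i j l, d i l <= d j l + #|I| &
        forall i, c (d i) = i \/ d i i <= #|I|].
Proof.
pose T : finType := {x : {ffun I -> 'I_N.+1} | \sum_l x l == N}.
have mk (x : I -> nat) : \sum_l x l = N -> exists t : T, forall l, val t l = x l :> nat.
  move=> sx; have xN l : x l < N.+1 by rewrite ltnS -sx (bigD1 l) ?leq_addr.
  have sx' : \sum_l [ffun l => Ordinal (xN l)] l == N.
    by rewrite -[X in _ == X]sx; apply/eqP/eq_bigr => l _; rewrite ffunE.
  by exists (Sub [ffun l => Ordinal (xN l)] sx') => l; rewrite ffunE.
pose r i (x : T) := val x i * #|T| + enum_rank x.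
have r_inj i : injective (r i).
  move=> x y /(congr1 (modn^~ #|T|)); rewrite /r !modnMDl !modn_small //.
  by move=> /val_inj/enum_rank_inj.
have r_le i x y : r i x <= r i y -> val x i <= val y i.
  apply: contraTT; rewrite -!ltnNge => lt.
  rewrite /r; apply: (@leq_trans ((val y i).+1 * #|T|)).
    by rewrite mulSn addnC ltn_add2r.
  by apply: leq_trans (leq_addr _ _); rewrite leq_mul2r lt orbT.
have [t0 _] := mk (fun l => if l == i0 then N else 0)
  (etrans (esym (big_mkcond _ _)) (big_pred1_eq _ i0 (fun=> N))).
have [D [C [domD colD]]] := scarf t0 i0 (fun x => c (val x)) r_inj.
have [i1 i1C _] := domD t0; have [d0 d0D _] := colD i1 i1C.
pose m i : nat := val [arg min_(x < d0 | x \in D) val x i] i.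
have mle i d : d \in D -> m i <= val d i.
  by rewrite /m; case: arg_minnP => // x _ h /h.
have mD i : exists2 d, d \in D & val d i = m i :> nat.
  by rewrite /m; case: arg_minnP => // x xD _; exists x.
(* Otherwise raising each minimum over [C] by one, with the surplus [e] put on [i1], would give a
   grid point above the minimum of [D] in every coordinate of [C], against dominance. *)
have sum_m : N < \sum_(i in C) m i + #|C|.
  rewrite -sum1_card -big_split /= ltnNge; apply/negP => le_N.
  pose e := N - \sum_(i in C) (m i + 1).
  have [|t tE] := mk (fun l => if l \in C then m l + 1 + (if l == i1 then e else 0) else 0).
    rewrite -big_mkcond big_split /= -big_mkcondr /=.
    suff -> : \sum_(i in C | i == i1) e = e by rewrite subnKC.
    rewrite (eq_bigl (pred1 i1)) ?big_pred1_eq // => l.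
    by rewrite /= andbC; case: eqP => // ->.
  have [i iC hi] := domD t; have [d dD dm] := mD i.
  by have := r_le _ _ _ (hi d dD); rewrite tE iC dm; lia.
have sum_d (d : T) : \sum_(i in C) val d i + \sum_(i | i \notin C) val d i = N.
  by apply: etrans (eqP (valP d)); rewrite [RHS](bigID (mem C)).
have dC d i : d \in D -> i \in C -> val d i < m i + #|C|.
  move=> dD iC; have := sum_d d; rewrite (bigD1 i) //= => sE.
  have : \sum_(j in C | j != i) m j <= \sum_(j in C | j != i) val d j.
    by apply: leq_sum => j _; apply: mle.
  by move: sum_m; rewrite (bigD1 i) //=; lia.
have dnC d i : d \in D -> i \notin C -> val d i < #|C|.
  move=> dD iC; have := sum_d d.
  have : \sum_(j in C) m j <= \sum_(j in C) val d j.
    by apply: leq_sum => j _; apply: mle.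
  have : val d i <= \sum_(j | j \notin C) val d j.
    by rewrite (bigD1 i iC) /= leq_addr.
  by move: sum_m; lia.
have CI : #|C| <= #|I| := max_card (mem C).
(* An index outside [C] may take any point of [D]: there the coordinate is below [#|C|]. *)
have [f fP] : exists f : I -> T, forall i,
    f i \in D /\ (c (val (f i)) = i \/ i \notin C).
  apply: (@fin_all_exists _ _ (fun i d => d \in D /\ (c (val d) = i \/ i \notin C))).
  move=> i; have [/colD[d dD cd]|iC] := boolP (i \in C).
    by exists d; split=> //; left.
  by exists d0; split=> //; right.
exists (fun i => val (f i)); split=> [i|i j l|i].
- exact/eqP/(valP (f i)).
- have [fiD _] := fP i; have [fjD _] := fP j; have [lC|lC] := boolP (l \in C).
    by apply: leq_trans (ltnW (dC _ _ fiD lC)) (leq_add (mle l _ fjD) CI).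
  by apply: leq_trans (leq_addl _ _); apply: leq_trans (ltnW (dnC _ _ fiD lC)) CI.
- have [fiD [->|iC]] := fP i; [by left|right].
  by apply: leq_trans (ltnW (dnC _ _ fiD iC)) CI.
Qed.

(** * Brouwer's fixed point theorem *)

Local Open Scope ring_scope.

(** A cluster point of solutions with error [1/(n+1)] works: if [phi j] were positive there, it
    would stay above half its value nearby, while along the sequence it eventually falls below that
    half. *)
Lemma compact_limit_le0 (R : realType) (X : topologicalType) (J : Type)
    (A : set X) (phi : J -> X -> R) :
  compact A -> (forall j, continuous (phi j)) ->
  (forall e, 0 < e -> exists2 x, A x & forall j, phi j x <= e) ->
  exists2 x, A x & forall j, phi j x <= 0.
Proof.
move=> cA cphi approx.
have /choice[u uP] : forall n : nat, exists x, A x /\ forall j, phi j x <= n.+1%:R^-1.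
  by move=> n; have [|x Ax le] := approx n.+1%:R^-1; [rewrite invr_gt0|exists x].
have FA : (u @ \oo)%classic A by exists 0%N => // n _; case: (uP n).
have [p [Ap clp]] := cA _ _ FA.
exists p => // j; rewrite leNgt; apply/negP => pj.
have pj2 : phi j p / 2 < phi j p by lra.
have near_p : nbhs p [set x | phi j p / 2 < phi j x]%classic.
  exact: (cvgr_gt _ (cphi j p)).
have near_u : (u @ \oo)%classic [set x | phi j x < phi j p / 2]%classic.
  have pj0 : 0 < phi j p / 2 by lra.
  exists (Num.truncn (phi j p / 2)^-1) => // n /= len.
  case: (uP n) => _ /(_ j) /le_lt_trans; apply.
  rewrite invf_plt ?posrE ?ltr0n //.
  by apply: lt_le_trans (truncnS_gt _) _; rewrite ler_nat ltnS.
have [x [/= lt gt]] := clp _ _ near_u near_p.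
by have := lt_trans lt gt; rewrite ltxx.
Qed.

(** * Topology of finite real products and continuity of real-valued functions *)

Section PointwiseTopology.
Variables (R : realType) (A : finType).

Lemma ptws_eval_continuous (a : A) : continuous (fun x : {ptws A -> R} => x a).
Proof. exact: (@proj_continuous A (fun=> R) a). Qed.

Lemma ptws_continuous (X : topologicalType) (f : X -> {ptws A -> R}) :
  (forall a, continuous (fun x => f x a)) -> continuous f.
Proof.
move=> cf x; apply/cvg_sup => a U [V [[W oW <-] WfN] WU].
apply: (filterS WU); apply: (cf a x); exact: open_nbhs_nbhs.
Qed.

Lemma cube_compact :
  compact [set x : {ptws A -> R} | forall a, 0 <= x a <= 1]%classic.
Proof.
have := @tychonoff A (fun=> R) _ (fun=> @segment_compact R 0 1).
by congr compact; apply/seteqP; split=> x /= h a; have := h a; rewrite /= in_itv.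
Qed.

End PointwiseTopology.

Section ContinuousFunctions.
Variables (R : realType) (X : topologicalType).
Implicit Types f g : X -> R.

Lemma continuous_const (a : R) : continuous (fun _ : X => a).
Proof. exact: cst_continuous. Qed.

Lemma continuous_addr f g :
  continuous f -> continuous g -> continuous (fun x => f x + g x).
Proof. by move=> cf cg x; apply: cvgD; [apply: cf|apply: cg]. Qed.

Lemma continuous_subr f g :
  continuous f -> continuous g -> continuous (fun x => f x - g x).
Proof. by move=> cf cg x; apply: cvgB; [apply: cf|apply: cg]. Qed.

Lemma continuous_mulr f g :
  continuous f -> continuous g -> continuous (fun x => f x * g x).
Proof. by move=> cf cg x; apply: cvgM; [apply: cf|apply: cg]. Qed.

Lemma continuous_divr f g : (forall x, g x != 0) ->
  continuous f -> continuous g -> continuous (fun x => f x / g x).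
Proof.
move=> g0 cf cg; apply: continuous_mulr => // x.
by apply: cvgV; [apply: g0|apply: cg].
Qed.

Lemma continuous_norm f : continuous f -> continuous (fun x => `|f x|).
Proof. by move=> cf x; apply: cvg_norm; apply: cf. Qed.

Lemma continuous_maxr f g :
  continuous f -> continuous g -> continuous (fun x => Num.max (f x) (g x)).
Proof. by move=> cf cg x; apply: continuous_max; [apply: cf|apply: cg]. Qed.

Lemma continuous_sum (I : Type) (r : seq I) (P : pred I) (F : I -> X -> R) :
  (forall i, P i -> continuous (F i)) ->
  continuous (fun x => \sum_(i <- r | P i) F i x).
Proof.
move=> cF; apply: continuous_big => // -[x y].
by apply: cvgD; [apply: cvg_fst|apply: cvg_snd].
Qed.

Lemma continuous_prod (I : Type) (r : seq I) (P : pred I) (F : I -> X -> R) :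
  (forall i, P i -> continuous (F i)) ->
  continuous (fun x => \prod_(i <- r | P i) F i x).
Proof.
move=> cF; apply: continuous_big => // -[x y].
by apply: cvgM; [apply: cvg_fst|apply: cvg_snd].
Qed.

Lemma continuous_pull (Y : topologicalType) (k : Y -> X) f :
  continuous k -> continuous f -> continuous (fun y => f (k y)).
Proof. by move=> ck cf y; apply: continuous_comp; [apply: ck|apply: cf]. Qed.

End ContinuousFunctions.
Arguments continuous_const {R X} a.

(* A grid point is coloured by a coordinate which h does not decrease; so a
   cluster point x of the clusters given by grid_sperner satisfies x <= h x
   coordinatewise, hence x = h x since both sum to 1. *)
Lemma brouwer_simplex (R : realType) (I : finType) (i0 : I)
    (h : {ptws I -> R} -> {ptws I -> R}) :
  continuous h -> (forall x i, 0 <= h x i) -> (forall x, \sum_i h x i = 1) ->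
  exists x, h x = x.
Proof.
move=> ch h0 h1.
pose row (i : I) (y : {ptws I * I -> R}) : {ptws I -> R} := fun l => y (i, l).
have ev p : continuous (fun y : {ptws I * I -> R} => y p).
  exact: ptws_eval_continuous.
have crow i : continuous (row i).
  by apply: ptws_continuous => l; apply: ev.
have chi i : continuous (fun x => h x i).
  exact: continuous_pull ch (@ptws_eval_continuous R I i).
(* [y] stacks one row for each vertex of a cluster. The constraints say that all rows agree, that
   row [i] is not decreased by [h] at coordinate [i], and that rows sum to 1. *)
pose phi (j : I * I * I + (I + I)) (y : {ptws I * I -> R}) : R := match j with
  | inl (i, j, l) => y (i, l) - y (j, l)
  | inr (inl i) => y (i, i) - h (row i y) i
  | inr (inr i) => `|\sum_l y (i, l) - 1| end.
have cphi j : continuous (phi j).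
  case: j => [[[i j] l]|[i|i]].
  - exact: continuous_subr (ev _) (ev _).
  - exact: continuous_subr (ev _) (continuous_pull (crow i) (chi i)).
  - have csum : continuous (fun y : {ptws I * I -> R} => \sum_l y (i, l)).
      by apply: continuous_sum => l _; apply: ev.
    exact: continuous_norm (continuous_subr csum (continuous_const 1)).
have [e e0|y _ yphi] := compact_limit_le0 (@cube_compact R (I * I)%type) cphi.
  pose N := (Num.truncn (#|I|%:R / e)).+1.
  have N0 : 0 < N%:R :> R by rewrite ltr0n.
  have leN : #|I|%:R / N%:R <= e.
    rewrite ler_pdivrMr // mulrC -ler_pdivrMr // ltW //.
    exact: truncnS_gt.
  pose p (x : {ffun I -> 'I_N.+1}) : {ptws I -> R} := fun l => (x l)%:R / N%:R.
  (* On points of the simplex some coordinate is not decreased, since both sides sum to 1; the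
     default [i0] never occurs there. *)
  pose c x := odflt i0 [pick i | p x i <= h (p x) i].
  have [d [dsum dle dc]] := grid_sperner i0 c.
  have psum i : \sum_l p (d i) l = 1.
    by rewrite -mulr_suml -natr_sum dsum divff // gt_eqF.
  exists (fun il => p (d il.1) il.2) => [[i l] /=|].
    rewrite divr_ge0 //= ?ler0n // ler_pdivrMr // mul1r ler_nat.
    by rewrite -ltnS.
  case=> [[[i j] l]|[i|i]] /=.
  - apply: le_trans leN; rewrite -mulrBl ler_pM2r ?invr_gt0 // lerBlDl.
    by rewrite -natrD ler_nat.
  - change (p (d i) i - h (p (d i)) i <= e); rewrite lerBlDr.
    have [ci|dii] := dc i.
      move: ci; rewrite /c; case: pickP => [l le|no] /= li.
        by rewrite li in le; apply: le_trans le _; rewrite lerDr ltW.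
      have : \sum_l h (p (d i)) l < \sum_l p (d i) l.
        apply: ltr_sum => [|l _]; last by rewrite ltNge no.
        by apply/hasP; exists i0; rewrite ?mem_index_enum.
      by rewrite h1 psum ltxx.
    (* Here the coordinate itself is at most [#|I|/N <= e], and [h] is nonnegative. *)
    apply: le_trans (_ : e <= _); last by rewrite lerDl.
    by apply: le_trans leN; rewrite ler_pM2r ?invr_gt0 // ler_nat.
  - by rewrite psum subrr normr0 ltW.
pose x := row i0 y.
have rowx i : row i y = x.
  apply/funext => l; apply: le_anti.
  have := yphi (inl (i, i0, l)); have := yphi (inl (i0, i, l)).
  by rewrite /phi !subr_le0 => le1 le2; apply/andP.
have xh i : x i <= h x i.
  have := yphi (inr (inl i)); rewrite /phi rowx subr_le0.
  by rewrite -[y (i, i)]/(row i y i) rowx.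
have x1 : \sum_i x i = 1.
  by have := yphi (inr (inr i0)); rewrite /phi normr_le0 subr_eq0 => /eqP.
exists x.
apply/funext => i; apply/eqP; rewrite -subr_eq0.
have : \sum_i (h x i - x i) == 0 by rewrite sumrB h1 x1 subrr.
by rewrite psumr_eq0 => [/allP/(_ i (mem_index_enum i))|j _] //; rewrite subr_ge0.
Qed.

(** Dividing by [#|A| + 1] embeds the cube in the simplex over [option A], where the coordinate
    [None] absorbs the missing mass. *)
Lemma brouwer_cube (R : realType) (A : finType)
    (h : {ptws A -> R} -> {ptws A -> R}) :
  continuous h -> (forall x a, 0 <= h x a <= 1) -> exists x, h x = x.
Proof.
move=> ch h01; pose M : R := #|A|.+1%:R.
have M0 : 0 < M by rewrite ltr0n.
pose s (z : {ptws option A -> R}) : {ptws A -> R} := fun a => M * z (Some a).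
pose H (z : {ptws option A -> R}) : {ptws option A -> R} := fun o =>
  if o is Some a then h (s z) a / M else 1 - (\sum_a h (s z) a) / M.
have cs : continuous s.
  apply: ptws_continuous => a; apply: continuous_mulr (continuous_const M) _.
  exact: ptws_eval_continuous.
have chs a : continuous (fun z => h (s z) a).
  have chx : continuous (fun x => h x a).
    exact: continuous_pull ch (@ptws_eval_continuous R A a).
  exact: continuous_pull cs chx.
have cH : continuous H.
  apply: ptws_continuous => -[a|].
    exact: continuous_mulr (chs a) (continuous_const M^-1).
  have csum : continuous (fun z => \sum_a h (s z) a).
    by apply: continuous_sum => a _; apply: chs.
  exact: continuous_subr (continuous_const 1)
    (continuous_mulr csum (continuous_const M^-1)).
have H0 z o : 0 <= H z o.
  case: o => [a|] /=; first by case/andP: (h01 (s z) a) => h0 _; rewrite divr_ge0 // ltW.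
  rewrite subr_ge0 ler_pdivrMr // mul1r.
  apply: (@le_trans _ _ (\sum_(a : A) 1)).
    by apply: ler_sum => a _; case/andP: (h01 (s z) a).
  by rewrite sumr_const ler_nat leqnSn.
have H1 z : \sum_o H z o = 1.
  rewrite (bigD1 None) //= (reindex_omap Some id) /= => [|[a|] //].
  rewrite -mulr_suml (eq_bigl (fun a => Some a == Some a)) ?subrK // => a.
  by rewrite eqxx.
have [z Hz] := brouwer_simplex None cH H0 H1.
exists (s z); apply/funext => a.
have -> : s z a = M * H z (Some a) by rewrite Hz.
by rewrite /H mulrC divfK // gt_eqF.
Qed.

(** * Finite distributions and sums over dependent choices *)

Lemma dist_ge0 (R : realType) (A : finType) (d : dist R A) a : 0 <= d a.
Proof. by case: d => v /= /andP[/forallP]. Qed.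

Lemma dist_sum1 (R : realType) (A : finType) (d : dist R A) : \sum_a d a = 1.
Proof. by case: d => v /= /andP[_ /eqP]. Qed.

Lemma dist_le1 (R : realType) (A : finType) (d : dist R A) a : d a <= 1.
Proof.
rewrite -(dist_sum1 d) (bigD1 a) //= lerDl sumr_ge0 // => b _.
exact: dist_ge0.
Qed.

Lemma dffun_sum_prod (R : comPzSemiRingType) (I : finType) (T : I -> finType)
    (F : forall i, T i -> R) :
  \sum_(u : {dffun forall i, T i}) \prod_i F i (u i) = \prod_i \sum_a F i a.
Proof.
pose F' i : {ffun T i -> R} := [ffun a => F i a].
transitivity (\sum_(t : fprod T) \prod_(i in I) F' i (t i)).
  rewrite (reindex (@dffun_of_fprod _ T)); last exact/onW_bij/dffun_of_fprod_bij.
  apply: eq_bigr => t _; apply: eq_bigr => i _.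
  by rewrite !ffunE.
rewrite big_fprod /= -(bigA_distr_big_dep (fun i => tagged_with T i)
  (fun i b => untag 0 (F' i) b)).
apply: eq_bigr => i _; rewrite -(big_tag (fun i a => F' i a)).
by apply: eq_bigr => a _; rewrite ffunE.
Qed.

(** * Expectations over one stage of the game *)

Section Outcomes.
Variables (R : realType) (G : game R) (g : profile G).
Arguments g : clear implicits.
Implicit Types (i : Pl G) (t : nat).

Lemma mu_ge0 t x h : 0 <= mu G g t x h.
Proof.
elim: t x h => [|t IH] x h /=; first exact: dist_ge0.
do 4 (apply: sumr_ge0 => ? _); case: ifP => // _.
by rewrite !mulr_ge0 ?dist_ge0 ?prodr_ge0 // => j _; apply: dist_ge0.
Qed.

Definition outcome t : finType :=
  (X G t * {dffun forall j, hist G j t} * {dffun forall j, U G t j} * W G t)%type.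

Definition own_hist t (s : outcome t) i : hist G i t := s.1.1.2 i.
Definition own_act t (s : outcome t) i : U G t i := s.1.2 i.
Definition transition t (s : outcome t) := f G t s.1.1.1 s.1.2 s.2.
Definition prob t (s : outcome t) : R :=
  weight G g t s.1.1.1 s.1.1.2 s.1.2 s.2.

Lemma sum_outcome t (F : X G t -> {dffun forall j, hist G j t} ->
    {dffun forall j, U G t j} -> W G t -> R) :
  \sum_x \sum_h \sum_u \sum_w F x h u w =
  \sum_(s : outcome t) F s.1.1.1 s.1.1.2 s.1.2 s.2.
Proof. by rewrite pair_bigA pair_bigA pair_bigA. Qed.

Lemma prob_ge0 t (s : outcome t) : 0 <= prob s.
Proof.
rewrite !mulr_ge0 ?mu_ge0 ?dist_ge0 ?prodr_ge0 // => j _.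
exact: dist_ge0.
Qed.

Lemma payoffE i :
  payoff G g i = \sum_(t < T G) \sum_(s : outcome t) prob s * (transition s).2 i.
Proof. by apply: eq_bigr => t _; rewrite sum_outcome. Qed.

Lemma Pr_huE i t hh uu : Pr_hu G g i t hh uu =
  \sum_(s : outcome t | (own_hist s i == hh) && (own_act s i == uu)) prob s.
Proof. by rewrite /Pr_hu sum_outcome [RHS]big_mkcond. Qed.

Lemma ER_huE i t hh uu : ER_hu g i t hh uu =
  \sum_(s : outcome t | (own_hist s i == hh) && (own_act s i == uu))
    prob s * (transition s).2 i.
Proof. by rewrite /ER_hu sum_outcome [RHS]big_mkcond. Qed.

Lemma Pr_hukE (C : compression G) i t hh uu k : Pr_huk C g i t hh uu k =
  \sum_(s : outcome t | (own_hist s i == hh) && (own_act s i == uu))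
    if iotaS C t i (kof C i t hh) ((transition s).1.2 i) == k then prob s else 0.
Proof.
rewrite /Pr_huk sum_outcome [RHS]big_mkcond; apply: eq_bigr => s _.
rewrite /own_hist /own_act; case: eqP => //= _.
by case: eqP => //= _; case: eqP.
Qed.

Lemma sum_own_acts i t (h : {dffun forall j, hist G j t}) (psi : U G t i -> R) :
  \sum_(u : {dffun forall j, U G t j}) (\prod_j g j t (h j) (u j)) * psi (u i) =
  \sum_a g i t (h i) a * psi a.
Proof.
transitivity (\sum_a \sum_(u : {dffun forall j, U G t j} | u i == a)
    (\prod_j g j t (h j) (u j)) * psi a).
  rewrite (partition_big (fun u : {dffun forall j, U G t j} => u i) xpredT) //=.
  by apply: eq_bigr => a _; apply: eq_bigr => u /eqP->.
apply: eq_bigr => a _; rewrite -mulr_suml; congr (_ * _).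
(* The event [u i == a] is absorbed into factor [i] of the product. Comparing tagged values makes
   the indicator typable for every [j]. *)
pose F j (b : U G t j) : R := g j t (h j) b *
  (if j == i then (Tagged (U G t) b == Tagged (U G t) a)%:R else 1).
transitivity (\sum_(u : {dffun forall j, U G t j}) \prod_j F j (u j)).
  rewrite big_mkcond; apply: eq_bigr => u _; rewrite big_split /=.
  rewrite [X in _ * X](bigD1 i) //= eqxx eq_Tagged /=.
  rewrite [X in _ * (_ * X)]big1 => [|j /negbTE -> //].
  by case: (u i == a); rewrite ?mulr1 ?mul0r ?mulr0.
rewrite dffun_sum_prod (bigD1 i) //= [X in _ * X]big1 => [|j /negbTE ji].
  rewrite mulr1 (bigD1 a) //= /F !eqxx mulr1 big1 ?addr0 // => b ba.
  by rewrite eq_Tagged /= (negbTE ba) mulr0.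
by rewrite -[RHS](dist_sum1 (g j t (h j))); apply: eq_bigr => b _; rewrite /F ji mulr1.
Qed.

Lemma sum_prob_own i t (psi : hist G i t -> U G t i -> R) :
  \sum_(s : outcome t) prob s * psi (own_hist s i) (own_act s i) =
  \sum_x \sum_h mu G g t x h * \sum_a g i t (h i) a * psi (h i) a.
Proof.
rewrite -(sum_outcome (fun x h u w => weight G g t x h u w * psi (h i) (u i))).
apply: eq_bigr => x _; apply: eq_bigr => h _.
rewrite -sum_own_acts mulr_sumr; apply: eq_bigr => u _.
rewrite -[RHS]mulr1 -[X in _ = _ * X](dist_sum1 (PW G t)) mulr_sumr; apply: eq_bigr => w _.
by rewrite /weight mulrA [RHS]mulrAC.
Qed.

Lemma sum_prob_hist i t (psi : hist G i t -> R) :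
  \sum_(s : outcome t) prob s * psi (own_hist s i) =
  \sum_x \sum_h mu G g t x h * psi (h i).
Proof.
rewrite (sum_prob_own (fun h _ => psi h)).
apply: eq_bigr => x _; apply: eq_bigr => h _.
by rewrite -mulr_suml dist_sum1 mul1r.
Qed.

(** Each outcome of stage [t] has exactly one successor pair of state and histories, so swapping the
    sums in the recursion of [mu] leaves one term per outcome. *)
Lemma sum_mu_next i t (psi : hist G i t.+1 -> R) :
  \sum_x \sum_h mu G g t.+1 x h * psi (h i) =
  \sum_(s : outcome t) prob s * psi (own_hist s i, (transition s).1.2 i).
Proof.
rewrite pair_bigA /=.
under eq_bigr do rewrite sum_outcome mulr_suml.
rewrite exchange_big; apply: eq_bigr => s _ /=.
pose h' : {dffun forall j, hist G j t.+1} :=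
  [ffun j => ((own_hist s j, (transition s).1.2 j) : hist G j t.+1)].
rewrite (bigD1 ((transition s).1.1, h')) //= [X in _ + X]big1 => [|[x h] ne].
  rewrite eqxx /= addr0 ffunE ifT //; apply/forallP => j.
  by rewrite ffunE.
rewrite /=; case: ifP => [/andP[/eqP xE /forallP hE]|_]; last by rewrite mul0r.
case/eqP: ne; rewrite -xE; congr (_, _); apply/ffunP => j.
by rewrite ffunE; apply/eqP/hE.
Qed.

End Outcomes.

(** * How the law of play depends on the strategies *)

Section Profiles.
Variables (R : realType) (G : game R).
Implicit Types (g : profile G).

Lemma sum_mu g (i : Pl G) t : \sum_x \sum_h mu G g t x h = 1.
Proof.
elim: t => [|t IH].
  by rewrite -(dist_sum1 (P0 G)) pair_bigA; apply: eq_bigr => -[].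
pose one t' := fun _ : hist G i t' => 1 : R.
have sum1 t' : \sum_x \sum_h mu G g t' x h =
               \sum_x \sum_h mu G g t' x h * one t' (h i).
  by apply: eq_bigr => x _; apply: eq_bigr => h _; rewrite mulr1.
by rewrite sum1 sum_mu_next (sum_prob_hist g (one t)) -sum1.
Qed.

Lemma eq_mu g g' t :
  (forall j s h u, (s < t)%N -> g j s h u = g' j s h u) ->
  forall x h, mu G g t x h = mu G g' t x h.
Proof.
elim: t => [|t IH] eg x h //=.
do 4 (apply: eq_bigr => ? _); case: ifP => // _.
rewrite IH => [|j s h' u st]; last by apply: eg; rewrite ltnW.
by congr (_ * _ * _); apply: eq_bigr => j _; rewrite eg.
Qed.

(** This lets profiles be compared that agree only within the horizon, as a profile and its finite
    encoding do. *)
Lemma eq_payoff g g' i :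
  (forall j t h u, (t < T G)%N -> g j t h u = g' j t h u) ->
  payoff G g i = payoff G g' i.
Proof.
move=> eg; apply: eq_bigr => t _; do 4 (apply: eq_bigr => ? _); rewrite /weight.
rewrite (@eq_mu g g') => [|j s h u st]; last exact/eg/(ltn_trans st).
by congr (_ * _ * _ * _); apply: eq_bigr => j _; rewrite eg.
Qed.

(** If all strategy factors are positive, a vanishing path probability is due to the initial law or
    the noise, which are common to both profiles. *)
Lemma mu_eq0 g g' t x h :
  (forall j s h u, (s < t)%N -> 0 < g j s h u) ->
  mu G g t x h = 0 -> mu G g' t x h = 0.
Proof.
elim: t x h => [|t IH] x h g0 //=.
have ge0 (gg : profile G) b y (h' : {dffun forall j, hist G j t})
    (u : {dffun forall j, U G t j}) w : 0 <= (if b : bool then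
    mu G gg t y h' * (\prod_j gg j t (h' j) (u j)) * PW G t w else 0).
  case: b => //; rewrite !mulr_ge0 ?mu_ge0 ?dist_ge0 ?prodr_ge0 // => j _.
  exact: dist_ge0.
move=> /eqP; rewrite psumr_eq0 => [/allP z1|? _]; last by do 3 (apply: sumr_ge0 => ? _).
apply: big1 => y _; move/(_ y (mem_index_enum y)): z1.
rewrite /= psumr_eq0 => [/allP z2|? _]; last by do 2 (apply: sumr_ge0 => ? _).
apply: big1 => h' _; move/(_ h' (mem_index_enum h')): z2.
rewrite /= psumr_eq0 => [/allP z3|? _]; last by apply: sumr_ge0 => ? _.
apply: big1 => u _; move/(_ u (mem_index_enum u)): z3.
rewrite /= psumr_eq0 => [/allP z4|? _] //.
apply: big1 => w _; move/(_ w (mem_index_enum w)): z4 => /=.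
case: ifP => // _; rewrite !mulf_eq0 => /orP[/orP[/eqP m0|]|/eqP->].
- by rewrite IH ?mul0r // => j s h'' u' st; apply: g0; rewrite ltnW.
- rewrite gt_eqF //; apply: prodr_gt0 => j _; exact: g0.
- by rewrite mulr0.
Qed.

Lemma dfwith_id g i : dfwith g (g i) = g.
Proof. by apply: functional_extensionality_dep => j; case: dfwithP. Qed.

End Profiles.

(** * The Markov decision process of one player *)

Section ControlledChain.
Variables (R : realType) (G : game R) (C : compression G) (i : Pl G).
Variable (r : forall t, K C t i -> U G t i -> R).
Variable (P : forall t, K C t i -> U G t i -> dist R (K C t.+1 i)).
Arguments r : clear implicits.
Arguments P : clear implicits.

(** The information-state identities multiplied through by [Pr_hu], so that they make sense at
    inadmissible pairs too, where both sides vanish. *)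
Definition controlled (g : profile G) :=
  forall t, (t < T G)%N -> forall hh uu,
    ER_hu g i t hh uu = Pr_hu G g i t hh uu * r t (kof C i t hh) uu /\
    ((t.+1 < T G)%N -> forall k, Pr_huk C g i t hh uu k =
       Pr_hu G g i t hh uu * P t (kof C i t hh) uu k).

(** The tower property: outcomes are grouped by the player's own history and action, and [phi] acts
    as a conditional expectation. *)
Lemma sum_own_split (g : profile G) t (F : outcome G t -> R) phi :
  (forall hh uu,
    \sum_(s | (own_hist s i == hh) && (own_act s i == uu)) F s =
    Pr_hu G g i t hh uu * phi hh uu) ->
  \sum_s F s = \sum_s prob g s * phi (own_hist s i) (own_act s i).
Proof.
move=> hF; pose p (s : outcome G t) := (own_hist s i, own_act s i).
rewrite (partition_big p xpredT) // [RHS](partition_big p xpredT) //=.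
apply: eq_bigr => -[hh uu] _.
rewrite (eq_bigl (fun s => (own_hist s i == hh) && (own_act s i == uu))) //.
rewrite hF Pr_huE mulr_suml; apply: eq_bigr => s /andP[/eqP-> /eqP->] //.
Qed.

Lemma sum_prob_reward g t : controlled g -> (t < T G)%N ->
  \sum_(s : outcome G t) prob g s * (transition s).2 i =
  \sum_(s : outcome G t) prob g s * r t (kof C i t (own_hist s i)) (own_act s i).
Proof.
move=> cg tT; apply: (sum_own_split (phi := fun hh => r t (kof C i t hh))).
by move=> hh uu; rewrite -ER_huE; have [] := cg t tT hh uu.
Qed.

Lemma sum_prob_next g t (V : K C t.+1 i -> R) : controlled g -> (t.+1 < T G)%N ->
  \sum_(s : outcome G t)
     prob g s * V (kof C i t.+1 (own_hist s i, (transition s).1.2 i)) =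
  \sum_(s : outcome G t) prob g s *
     \sum_k P t (kof C i t (own_hist s i)) (own_act s i) k * V k.
Proof.
move=> cg tT.
apply: (sum_own_split (phi := fun hh uu => \sum_k P t (kof C i t hh) uu k * V k)).
move=> hh uu; have [_ /(_ tT) hP] := cg t (ltnW tT) hh uu.
rewrite mulr_sumr; under [RHS]eq_bigr do rewrite mulrA -hP Pr_hukE mulr_suml.
rewrite exchange_big; apply: eq_bigr => s /andP[/eqP hs _] /=.
rewrite (bigD1 (iotaS C t i (kof C i t hh) ((transition s).1.2 i))) //= eqxx hs.
by rewrite big1 ?addr0 // => k /negbTE; rewrite eq_sym => ->; rewrite mul0r.
Qed.

Variable rho : kstrat C i.
Arguments rho : clear implicits.

(** Expected reward of [rho] over the next [n] stages of the decision process; the recursion is on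
    [n] because the time [t] increases. *)
Fixpoint reward_to_go n : forall t, K C t i -> R := fun t k =>
  if n is n'.+1 then
    \sum_u rho t k u * (r t k u + \sum_k' P t k u k' * reward_to_go n' k')
  else 0.

Definition value t (k : K C t i) := reward_to_go (T G - t) k.
Definition qvalue t (k : K C t i) u :=
  r t k u + \sum_k' P t k u k' * value k'.

Lemma valueE t (k : K C t i) : (t < T G)%N ->
  value k = \sum_u rho t k u * qvalue k u.
Proof. by move=> tT; rewrite /value -subnSK. Qed.

Lemma value_end t (k : K C t i) : (T G <= t)%N -> value k = 0.
Proof. by rewrite -subn_eq0 /value => /eqP->. Qed.

Lemma sum_rho_advantage t (k : K C t i) : (t < T G)%N ->
  \sum_u rho t k u * (qvalue k u - value k) = 0.
Proof.
move=> tT; under eq_bigr do rewrite mulrBr.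
by rewrite sumrB -valueE // -mulr_suml dist_sum1 mul1r subrr.
Qed.

Definition initial_value :=
  \sum_x \sum_(h : {dffun forall j, hist G j 0}) P0 G (x, h) * value (kof C i 0 (h i)).

(** The mean advantage at stage [t] equals the mean reward plus [M t.+1 - M t], with [M] the mean
    under [g] of the value of [rho]; the differences telescope to [- initial_value]. *)
Lemma performance_difference g : controlled g ->
  payoff G g i = initial_value + \sum_(t < T G) \sum_(s : outcome G t)
    prob g s * (qvalue (kof C i t (own_hist s i)) (own_act s i)
                - value (kof C i t (own_hist s i))).
Proof.
move=> cg; pose M t := \sum_x \sum_h mu G g t x h * value (kof C i t (h i)).
have M_end t : (T G <= t)%N -> M t = 0.
  by move=> Tt; do 2 (apply: big1 => ? _); rewrite value_end ?mulr0.
have step t : (t < T G)%N -> \sum_(s : outcome G t)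
    prob g s * (qvalue (kof C i t (own_hist s i)) (own_act s i)
                - value (kof C i t (own_hist s i))) =
    \sum_(s : outcome G t) prob g s * (transition s).2 i + (M t.+1 - M t).
  move=> tT; under eq_bigr do rewrite mulrBr mulrDr.
  rewrite sumrB big_split /= -sum_prob_reward // addrA; congr (_ + _ - _).
    (* At the last stage no transition law is given, but the value beyond the horizon is 0. *)
    have [tT1|tT1] := ltnP t.+1 (T G).
      rewrite -sum_prob_next // /M.
      by rewrite (sum_mu_next g (fun h => value (kof C i t.+1 h))).
    rewrite M_end // big1 // => s _.
    by rewrite big1 ?mulr0 // => k _; rewrite value_end ?mulr0.
  by rewrite (sum_prob_hist g (fun h => value (kof C i t h))).
rewrite payoffE; under [X in _ = _ + X]eq_bigr do rewrite step //.
rewrite big_split /= addrCA -[LHS]addr0; congr (_ + _).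
rewrite -[initial_value]/(M 0%N) -(big_mkord xpredT (fun t => M t.+1 - M t)) telescope_sumr //.
by rewrite addrC subrK M_end.
Qed.

Hypothesis r_bound : forall t k u, `|r t k u| <= 1.

Lemma qvalue_bound t (k : K C t i) u : (t < T G)%N -> `|qvalue k u| <= (T G)%:R.
Proof.
have average (A : finType) (d : dist R A) (F : A -> R) b :
    (forall a, `|F a| <= b) -> `|\sum_a d a * F a| <= b.
  move=> Fb; apply: le_trans (ler_norm_sum _ _ _) _.
  rewrite -[b]mul1r -(dist_sum1 d) mulr_suml; apply: ler_sum => a _.
  by rewrite normrM ger0_norm ?dist_ge0 // ler_wpM2l ?dist_ge0.
have bound n : forall t (k : K C t i), `|reward_to_go n k| <= n%:R.
  elim: n => [|n IH] t' k' /=; first by rewrite normr0.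
  apply: (average) => a; apply: le_trans (ler_normD _ _) _.
  by rewrite -natr1 addrC; apply: lerD => //; apply: (average).
move=> tT; apply: le_trans (ler_normD _ _) _.
apply: (@le_trans _ _ (1 + (T G - t.+1)%:R)).
  by apply: lerD => //; apply: (average) => k'; apply: bound.
by rewrite addrC natr1 ler_nat; lia.
Qed.

End ControlledChain.

Lemma info_state_controlled (R : realType) (G : game R) (C : compression G)
    (g : profile G) i : info_state C g i ->
  exists (r : forall t, K C t i -> U G t i -> R) P,
    (forall t k u, `|r t k u| <= 1) /\
    forall gi : strat G i, controlled r P (dfwith g gi).
Proof.
case=> P [r [r1 Pr]]; exists r, P; split=> [t k u|gi t tT hh uu].
  by rewrite ler_norml.
have := Pr gi t tT hh uu; rewrite lt0r => {}Pr.
have Pr_ge0 : 0 <= Pr_hu G (dfwith g gi) i t hh uu.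
  by rewrite Pr_huE; apply: sumr_ge0 => s _; apply: prob_ge0.
move: Pr; rewrite Pr_ge0 andbT.
have [Pr0 _|Prn0 /(_ isT)[Pk <-]] := eqVneq (Pr_hu G (dfwith g gi) i t hh uu) 0.
  have prob0 s : (own_hist s i == hh) && (own_act s i == uu) ->
      prob (dfwith g gi) s = 0.
    move=> sP; apply/eqP; move/eqP: Pr0; rewrite Pr_huE psumr_eq0.
      by move/allP/(_ s (mem_index_enum s)); rewrite sP.
    by move=> ? _; apply: prob_ge0.
  rewrite Pr0; split=> [|_ k]; rewrite mul0r.
    by rewrite ER_huE big1 // => s /prob0->; rewrite mul0r.
  by rewrite Pr_hukE big1 // => s /prob0->; case: ifP.
split=> [|tT1 k]; first by rewrite mulrC divfK.
by rewrite -Pk // mulrC divfK.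
Qed.

(** * Trembles and one-shot deviations *)

Section Distributions.
Variables (R : realType) (A : finType).

Lemma dist_of_subproof (v : A -> R) : (forall a, 0 <= v a) -> \sum_a v a = 1 ->
  [forall a, 0 <= [ffun a => v a] a] && (\sum_a [ffun a => v a] a == 1).
Proof.
move=> v0 v1; apply/andP; split; first by apply/forallP => a; rewrite ffunE.
by apply/eqP; rewrite -v1; apply: eq_bigr => a _; rewrite ffunE.
Qed.

Definition dist_of (v : A -> R) v0 v1 : dist R A :=
  @Dist R A _ (@dist_of_subproof v v0 v1).

Lemma dist_ofE (v : A -> R) v0 v1 a : @dist_of v v0 v1 a = v a.
Proof. by rewrite /= ffunE. Qed.

Lemma pure_ge0 (a b : A) : 0 <= (b == a)%:R :> R.
Proof. by rewrite ler0n. Qed.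

Lemma pure_sum1 (a : A) : \sum_b (b == a)%:R = 1 :> R.
Proof. by rewrite (bigD1 a) //= eqxx big1 ?addr0 // => b /negbTE->. Qed.

Definition pure a : dist R A := dist_of (pure_ge0 a) (pure_sum1 a).

Lemma sum_pure a (F : A -> R) : \sum_b pure a b * F b = F a.
Proof.
rewrite (bigD1 a) //= ffunE eqxx mul1r big1 ?addr0 // => b /negbTE ba.
by rewrite ffunE ba mul0r.
Qed.

Hypothesis A0 : (0 < #|A|)%N.

Lemma uniform_sum1 : \sum_(a : A) #|A|%:R^-1 = 1 :> R.
Proof. by rewrite sumr_const -[LHS]mulr_natr mulVf // pnatr_eq0 -lt0n. Qed.

Lemma tremble_ge0 n (d : dist R A) a :
  0 <= (n%:R * d a + #|A|%:R^-1) / n.+1%:R.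
Proof. by rewrite divr_ge0 ?addr_ge0 ?mulr_ge0 ?dist_ge0 ?invr_ge0 ?ler0n. Qed.

Lemma tremble_sum1 n (d : dist R A) :
  \sum_a (n%:R * d a + #|A|%:R^-1) / n.+1%:R = 1.
Proof.
rewrite -mulr_suml big_split /= -mulr_sumr dist_sum1 uniform_sum1 mulr1 natr1.
by rewrite divff ?pnatr_eq0.
Qed.

(** The mixture of [d] with weight [n/(n+1)] and the uniform law with weight [1/(n+1)]. *)
Definition tremble n d : dist R A := dist_of (tremble_ge0 n d) (tremble_sum1 n d).

Lemma tremble_gt0 n d a : 0 < tremble n d a.
Proof.
rewrite ffunE divr_gt0 ?ltr0n // ltr_wpDl ?mulr_ge0 ?dist_ge0 //.
by rewrite invr_gt0 ltr0n.
Qed.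

(* Shaped so as to be total and continuous in y, and equal to y when y already
   is a probability vector. *)
Definition normal_weight (y : A -> R) : A -> R := fun a =>
  (Num.max 0 (y a) + Num.max 0 (1 - \sum_b Num.max 0 (y b)) / #|A|%:R) /
  Num.max 1 (\sum_b Num.max 0 (y b)).

Lemma normal_weight_ge0 y a : 0 <= normal_weight y a.
Proof.
rewrite divr_ge0 //; last by rewrite le_max ler01.
by rewrite addr_ge0 ?divr_ge0 ?ler0n // le_max lexx.
Qed.

Lemma normal_weight_sum1 y : \sum_a normal_weight y a = 1.
Proof.
rewrite -mulr_suml big_split /= -mulr_sumr uniform_sum1 mulr1.
set s := \sum_b _.
have -> : s + Num.max 0 (1 - s) = Num.max 1 s.
  by have [s1|s1] := leP s 1; [rewrite max_r ?max_l | rewrite max_l ?max_r]; lra.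
by rewrite divff // gt_eqF // lt_max ltr01.
Qed.

Definition normalize y := dist_of (normal_weight_ge0 y) (normal_weight_sum1 y).

Lemma normalize_id y a : (forall b, 0 <= y b) -> \sum_b y b = 1 ->
  normalize y a = y a.
Proof.
move=> y0 y1; rewrite ffunE /normal_weight max_r //.
have -> : \sum_b Num.max 0 (y b) = 1.
  by rewrite -y1; apply: eq_bigr => b _; rewrite max_r.
by rewrite subrr !maxxx mul0r addr0 divr1.
Qed.

End Distributions.

(** * Payoffs of one-shot deviations *)

Section OneShot.
Variables (R : realType) (G : game R) (C : compression G).

Definition one_shot (rho : kprofile C) i t (k : K C t i) a : kstrat C i :=
  @dfwith nat (fun t => K C t i -> dist R (U G t i)) (rho i) t
    (fun k' => if k' == k then pure R a else rho i t k').

Definition one_shot_payoff rho i t (k : K C t i) a : R :=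
  payoff G (dfwith (kprofile_beh C rho) (kstrat_beh C i (one_shot rho k a))) i.

Variables (rho : kprofile C) (i : Pl G).
Arguments rho : clear implicits.
Variable (r : forall t, K C t i -> U G t i -> R).
Variable (P : forall t, K C t i -> U G t i -> dist R (K C t.+1 i)).
Hypothesis ctl : forall gi : strat G i,
  controlled r P (dfwith (kprofile_beh C rho) gi).

Let g := kprofile_beh C rho.
Let V t := @value R G C i r P (rho i) t.
Let Q t := @qvalue R G C i r P (rho i) t.

Definition reach t (k : K C t i) : R :=
  \sum_x \sum_h mu G g t x h * (kof C i t (h i) == k)%:R.

Lemma payoff_value : payoff G g i = initial_value r P (rho i).
Proof.
rewrite (performance_difference (r := r) (P := P) (rho i)); last first.
  by rewrite -[g](dfwith_id _ i).
rewrite big1 ?addr0 // => t _.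
rewrite (sum_prob_own g (fun hh u => Q (kof C i t hh) u - V (kof C i t hh))).
do 2 (apply: big1 => ? _); rewrite sum_rho_advantage ?mulr0 //.
Qed.

(** In the performance difference every other stage has mean advantage zero, as the deviator follows
    [rho] there. The factor [reach] is unaffected by the deviation, since both strategies agree
    before [t]. *)
Lemma one_shot_payoffE t (k : K C t i) a : (t < T G)%N ->
  one_shot_payoff rho k a = payoff G g i + reach k * (Q k a - V k).
Proof.
move=> tT; rewrite payoff_value.
rewrite /one_shot_payoff (performance_difference (rho i) (ctl _)).
congr (_ + _); set gg := dfwith _ _.
have ggi : gg i = kstrat_beh C i (one_shot rho k a) by rewrite /gg dfwith_in.
have term t' : (t' < T G)%N -> t' != t -> \sum_(s : outcome G t')
    prob gg s * (Q (kof C i t' (own_hist s i)) (own_act s i)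
                 - V (kof C i t' (own_hist s i))) = 0.
  move=> t'T t't.
  rewrite (sum_prob_own gg (fun hh u => Q (kof C i t' hh) u - V (kof C i t' hh))).
  do 2 (apply: big1 => ? _); rewrite ggi /kstrat_beh /one_shot dfwith_out 1?eq_sym //.
  by rewrite sum_rho_advantage ?mulr0.
rewrite (bigD1 (Ordinal tT)) //= [X in _ + X]big1 ?addr0 => [|t' t't]; last first.
  by apply: term => //; apply: contra t't => /eqP e; apply/eqP/val_inj.
rewrite (sum_prob_own gg (fun hh u => Q (kof C i t hh) u - V (kof C i t hh))).
rewrite /reach mulr_suml; apply: eq_bigr => x _; rewrite mulr_suml.
apply: eq_bigr => h _; rewrite -mulrA.
congr (_ * _).
  apply: eq_mu => j s h' u st; rewrite /gg.
  have [ji|ji] := eqVneq i j; last by rewrite dfwith_out.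
  subst j; rewrite dfwith_in /kstrat_beh /one_shot dfwith_out //.
  by rewrite gtn_eqF.
rewrite ggi /kstrat_beh /one_shot dfwith_in; case: eqP => [->|_].
  by rewrite mul1r sum_pure.
by rewrite mul0r sum_rho_advantage.
Qed.

End OneShot.

(** * From one-shot optimality to approximate equilibrium *)

Section TremblingEquilibrium.
Variables (R : realType) (G : game R) (C : compression G).
Hypothesis U0 : forall t i, (0 < #|U G t i|)%N.

Definition tremble_profile n (x : kprofile C) : kprofile C :=
  fun i t k => tremble (U0 t i) n (x i t k).
Arguments tremble_profile : clear implicits.

Lemma trembling_equilibrium n (x : kprofile C) : MSI C ->
  (forall i t (k : K C t i) a, (t < T G)%N ->
     one_shot_payoff (tremble_profile n x) k a <=
     \sum_b x i t k b * one_shot_payoff (tremble_profile n x) k b) ->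
  forall i (gi : strat G i),
    payoff G (dfwith (kprofile_beh C (tremble_profile n x)) gi) i <=
    payoff G (kprofile_beh C (tremble_profile n x)) i +
    2 * (T G)%:R ^+ 2 / n.+1%:R.
Proof.
move=> msi NE i gi; set rho := tremble_profile n x; set g := kprofile_beh C rho.
have [r [P [r1 ctl]]] := info_state_controlled (msi i rho).
pose V t := @value R G C i r P (rho i) t.
pose Q t := @qvalue R G C i r P (rho i) t.
have gain t (k : K C t i) a : (t < T G)%N -> 0 < reach rho k ->
    Q t k a - V t k <= 2 * (T G)%:R / n.+1%:R.
  move=> tT reach0; have := NE i t k a tT; rewrite -/rho.
  under eq_bigr do rewrite (one_shot_payoffE ctl) //.
  rewrite (one_shot_payoffE ctl) //; under eq_bigr do rewrite mulrDr mulrCA.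
  rewrite big_split /= -mulr_suml dist_sum1 mul1r lerD2l -mulr_sumr ler_pM2l //.
  under eq_bigr do rewrite mulrBr.
  rewrite sumrB -mulr_suml dist_sum1 mul1r lerD2r => Qa.
  have Qb b : `|Q t k b| <= (T G)%:R by apply: qvalue_bound.
  rewrite -/(Q t) in Qa *; set S := \sum_b _ in Qa.
  set N := #|U G t i|%:R^-1 : R.
  (* The tremble splits [V] into the [x]-mean [S], which bounds [Q t k a], and the uniform mean of
     [Q]. Both lie within [T G] of zero; hence the constant [2 * T G]. *)
  have VE : n.+1%:R * V t k = n%:R * S + \sum_b N * Q t k b.
    rewrite /V valueE // mulr_sumr /S mulr_sumr -big_split /=; apply: eq_bigr => b _.
    rewrite ffunE -/N mulrA [_ * (_ / _)]mulrCA divff ?pnatr_eq0 // mulr1.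
    by rewrite mulrDl mulrA.
  rewrite ler_pdivlMr ?ltr0n // mulrBl [V t k * _]mulrC VE.
  have le_avg : - (T G)%:R <= \sum_b N * Q t k b.
    rewrite -[leLHS]mul1r -[X in X * _ <= _](uniform_sum1 R (U0 t i)) mulr_suml.
    apply: ler_sum => b _; rewrite ler_wpM2l ?invr_ge0 ?ler0n //.
    by have := Qb b; rewrite ler_norml => /andP[].
  have SE : S <= (T G)%:R.
    rewrite -[leRHS]mul1r -[X in _ <= X * _](dist_sum1 (x i t k)) mulr_suml.
    apply: ler_sum => b _; rewrite ler_wpM2l ?dist_ge0 //.
    by have := Qb b; rewrite ler_norml => /andP[].
  have : Q t k a * n.+1%:R <= S * n.+1%:R by rewrite ler_wpM2r ?ler0n.
  by rewrite -natr1; lra.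
rewrite (performance_difference (rho i) (ctl gi)) (payoff_value ctl) lerD2l.
apply: (@le_trans _ _ (\sum_(t < T G) (2 * (T G)%:R / n.+1%:R))); last first.
  by rewrite sumr_const card_ord -[leLHS]mulr_natr expr2 [2 * (_ * _)]mulrA [leRHS]mulrAC.
apply: ler_sum => t _.
set gg := dfwith _ _.
have mass : \sum_(s : outcome G t) prob gg s = 1.
  pose one := fun _ : hist G i t => 1 : R.
  transitivity (\sum_(s : outcome G t) prob gg s * one (own_hist s i)).
    by apply: eq_bigr => s _; rewrite mulr1.
  rewrite sum_prob_hist -(sum_mu gg i t).
  by do 2 (apply: eq_bigr => ? _); rewrite mulr1.
rewrite -[leRHS]mul1r -[X in _ <= X * _]mass mulr_suml; apply: ler_sum => s _.
(* Outcomes of probability zero contribute nothing. On the others the history has positive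
   probability under the trembling profile as well, so [reach] is positive and [gain] applies. *)
have [->|prob0] := eqVneq (prob gg s) 0; first by rewrite !mul0r.
rewrite ler_wpM2l ?prob_ge0 //; apply: gain => //.
set h := own_hist s i; have mu0 : mu G g t s.1.1.1 s.1.1.2 != 0.
  apply: contra prob0 => /eqP m0; rewrite /prob /weight.
  rewrite (mu_eq0 gg _ m0) ?mul0r // => j t' h' u _.
  exact: tremble_gt0.
rewrite /reach (bigD1 s.1.1.1) //= (bigD1 s.1.1.2) //= eqxx mulr1.
rewrite -addrA ltr_wpDr //; last by rewrite lt0r mu0 mu_ge0.
by rewrite addr_ge0 ?sumr_ge0 // => ? _; rewrite ?sumr_ge0 // => *;
  rewrite mulr_ge0 ?mu_ge0 ?ler0n.
Qed.

End TremblingEquilibrium.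
Arguments tremble_profile {R G C} U0 n x i t k.

(** * Nash's map and the limit of vanishing trembles *)

Section PayoffContinuity.
Variables (R : realType) (G : game R) (X : topologicalType).

Lemma payoff_continuous (gg : X -> profile G) i :
  (forall j t h u, continuous (fun x => gg x j t h u)) ->
  continuous (fun x => payoff G (gg x) i).
Proof.
move=> cg.
have cprod t (h : {dffun forall j, hist G j t}) (u : {dffun forall j, U G t j}) :
    continuous (fun x => \prod_j gg x j t (h j) (u j)).
  by apply: continuous_prod => j _; apply: cg.
have cmu t y h : continuous (fun x => mu G (gg x) t y h).
  elim: t y h => [|t IH] y h /=; first exact: continuous_const.
  do 4 (apply: continuous_sum => ? _); case: (_ && _); last exact: continuous_const.
  exact: continuous_mulr (continuous_mulr (IH _ _) (cprod _ _ _))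
    (continuous_const (PW G t _)).
apply: continuous_sum => t _; do 4 (apply: continuous_sum => ? _).
exact: continuous_mulr (continuous_mulr (continuous_mulr (cmu _ _ _) (cprod _ _ _))
  (continuous_const (PW G t _))) (continuous_const _).
Qed.

Lemma dfwith_continuous (g : X -> profile G) i (gi : X -> strat G i) :
  (forall j t h u, continuous (fun x => g x j t h u)) ->
  (forall t h u, continuous (fun x => gi x t h u)) ->
  forall j t h u, continuous (fun x => dfwith (g x) (gi x) j t h u).
Proof.
move=> cg cgi j t h u; have [ij|ij] := eqVneq i j.
  subst j; rewrite (_ : (fun x => _) = (fun x => gi x t h u)) //.
  by apply/funext => x; rewrite dfwith_in.
rewrite (_ : (fun x => _) = (fun x => g x j t h u)) //.
by apply/funext => x; rewrite dfwith_out.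
Qed.

Lemma normal_weight_continuous (A : finType) (v : X -> A -> R) a :
  (forall b, continuous (fun x => v x b)) ->
  continuous (fun x => normal_weight (v x) a).
Proof.
move=> cv.
have cpos b : continuous (fun x => Num.max 0 (v x b)).
  exact: continuous_maxr (continuous_const 0) (cv b).
have csum : continuous (fun x => \sum_b Num.max 0 (v x b)).
  by apply: continuous_sum => b _; apply: cpos.
apply: continuous_divr => [x||].
- by rewrite gt_eqF // lt_max ltr01.
- apply: continuous_addr => //.
  exact: continuous_mulr (continuous_maxr (continuous_const 0)
    (continuous_subr (continuous_const 1) csum)) (continuous_const #|A|%:R^-1).
- exact: continuous_maxr (continuous_const 1) csum.
Qed.

End PayoffContinuity.

Section NashMap.
Variables (R : realType) (G : game R) (C : compression G).
Hypothesis U0 : forall t i, (0 < #|U G t i|)%N.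

(** Times are limited to the horizon to keep the index set of the cube finite. *)
Definition agent_action : finType :=
  {i : Pl G & {t : 'I_(T G) & (K C t i * U G t i)%type}}.

Definition agent_action_at i t (tT : (t < T G)%N) (k : K C t i) (u : U G t i) :
    agent_action :=
  existT _ i (existT (fun t : 'I_(T G) => (K C t i * U G t i)%type)
                     (Ordinal tT) (k, u)).

(** The weight 0 beyond the horizon is normalised by [decode] to the uniform law. *)
Definition agent_weight (y : {ptws agent_action -> R}) i t (k : K C t i) u : R :=
  match @idP (t < T G)%N with
  | ReflectT tT => y (agent_action_at tT k u)
  | ReflectF _ => 0
  end.

Lemma agent_weightE y i t (tT : (t < T G)%N) (k : K C t i) u :
  agent_weight y k u = y (agent_action_at tT k u).
Proof.
rewrite /agent_weight; case: {-}_ / idP => // tT'.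
by rewrite (bool_irrelevance tT' tT).
Qed.

Lemma agent_weight_continuous i t (k : K C t i) u : continuous (fun y => agent_weight y k u).
Proof.
rewrite /agent_weight; case: {-}_ / idP => [tT|_]; last exact: continuous_const.
exact: ptws_eval_continuous.
Qed.

Definition decode (y : {ptws agent_action -> R}) : kprofile C :=
  fun i t k => normalize (U0 t i) (agent_weight y k).
Arguments decode : clear implicits.

Lemma decode_continuous i t k u : continuous (fun y => decode y i t k u).
Proof.
rewrite (_ : (fun y => _) = (fun y => normal_weight (agent_weight y k) u)).
  by apply: normal_weight_continuous => b; apply: agent_weight_continuous.
by apply/funext => y; rewrite ffunE.
Qed.

Variable n : nat.

Let J (y : {ptws agent_action -> R}) i t (k : K C t i) a : R :=
  one_shot_payoff (tremble_profile U0 n (decode y)) k a.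

Lemma one_shot_payoff_continuous i t (k : K C t i) a : continuous (fun y => J y k a).
Proof.
have ctremble j t' (k' : K C t' j) u :
    continuous (fun y => tremble_profile U0 n (decode y) j t' k' u).
  rewrite (_ : (fun y => _) =
    (fun y => (n%:R * decode y j t' k' u + #|U G t' j|%:R^-1) / n.+1%:R)).
    exact: continuous_mulr (continuous_addr (continuous_mulr (continuous_const n%:R)
      (@decode_continuous j t' k' u)) (continuous_const _)) (continuous_const n.+1%:R^-1).
  by apply/funext => y; rewrite /tremble_profile /tremble dist_ofE.
apply: payoff_continuous; apply: dfwith_continuous => [j t' h u|t' h u].
  exact: ctremble.
rewrite /kstrat_beh /one_shot; have [tt'|tt'] := eqVneq t t'.
  subst t'; rewrite (_ : (fun y => _) = (fun y => (if kof C i t h == k then pure R a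
    else tremble_profile U0 n (decode y) i t (kof C i t h)) u)); last first.
    by apply/funext => y; rewrite dfwith_in.
  by case: (_ == _); [apply: continuous_const|apply: ctremble].
rewrite (_ : (fun y => _) = 
  (fun y => tremble_profile U0 n (decode y) i t' (kof C i t' h) u)) //.
by apply/funext => y; rewrite dfwith_out.
Qed.

Let gain (y : {ptws agent_action -> R}) i t (k : K C t i) a : R :=
  Num.max 0 (J y k a - \sum_b decode y i t k b * J y k b).

Let nash_value y i t (k : K C t i) a : R :=
  (decode y i t k a + gain y k a) / (1 + \sum_b gain y k b).

(** At a fixed point of Nash's map each gain is the action's weight times the total gain, so the
    gains are orthogonal to the payoff excesses [J y k b - m]. All products are nonnegative, and a
    positive excess would make one positive. *)
Lemma one_shot_equilibrium : exists x : kprofile C,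
  forall i t (k : K C t i) a, (t < T G)%N ->
    one_shot_payoff (tremble_profile U0 n x) k a <=
    \sum_b x i t k b * one_shot_payoff (tremble_profile U0 n x) k b.
Proof.
have gain_ge0 y i t (k : K C t i) a : 0 <= gain y k a by rewrite le_max lexx.
have gains_ge0 y i t (k : K C t i) : 0 <= \sum_b gain y k b by apply: sumr_ge0.
have den_gt0 y i t (k : K C t i) : 0 < 1 + \sum_b gain y k b.
  by rewrite ltr_wpDr.
have cgain i t (k : K C t i) a : continuous (fun y => gain y k a).
  apply: continuous_maxr (continuous_const 0) _.
  apply: continuous_subr; first exact: one_shot_payoff_continuous.
  apply: continuous_sum => b _.
  exact: continuous_mulr (@decode_continuous _ _ _ _) (@one_shot_payoff_continuous _ _ _ _).
pose h (y : {ptws agent_action -> R}) : {ptws agent_action -> R} :=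
  fun b => nash_value y (tagged (tagged b)).1 (tagged (tagged b)).2.
have nash_ge0 y i t (k : K C t i) a : 0 <= nash_value y k a.
  by rewrite divr_ge0 ?addr_ge0 ?dist_ge0.
have nash_sum1 y i t (k : K C t i) : \sum_a nash_value y k a = 1.
  transitivity ((\sum_a decode y i t k a + \sum_b gain y k b) /
                (1 + \sum_b gain y k b)).
    by rewrite -mulr_suml big_split.
  by rewrite dist_sum1 divff // gt_eqF.
have [||y yfix] := @brouwer_cube R agent_action h.
- apply: ptws_continuous => -[i [t [k a]]].
  apply: continuous_divr => [y||].
  + by rewrite gt_eqF.
  + exact: continuous_addr (@decode_continuous _ _ _ _) (@cgain _ _ _ _).
  + apply: continuous_addr (continuous_const 1) _.
    by apply: continuous_sum => b _; apply: cgain.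
- move=> y b; rewrite nash_ge0 /= -(nash_sum1 y _ _ (tagged (tagged b)).1).
  by rewrite (bigD1 (tagged (tagged b)).2) //= lerDl sumr_ge0.
exists (decode y) => i t k a tT; rewrite -subr_le0 -/(J y k a).
(* At the fixed point the weights of an agent already form a probability vector, so [decode] leaves
   them unchanged. *)
have fixE b : decode y i t k b = nash_value y k b.
  have coordN c : agent_weight y k c = nash_value y k c.
    by rewrite (agent_weightE y tT) -[in LHS]yfix.
  rewrite -coordN; apply: normalize_id => [c|]; first by rewrite coordN.
  by rewrite -(nash_sum1 y i t k); apply: eq_bigr => c _; apply: coordN.
set m := \sum_b _.
have gainE b : gain y k b = decode y i t k b * \sum_c gain y k c.
  have : decode y i t k b * (1 + \sum_c gain y k c) = decode y i t k b + gain y k b.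
    by rewrite {1}fixE divfK // gt_eqF.
  by rewrite mulrDr mulr1 => /addrI.
have : \sum_b gain y k b * (J y k b - m) = 0.
  under eq_bigr do rewrite gainE mulrAC mulrBr.
  rewrite -mulr_suml sumrB -[X in _ - X]mulr_suml dist_sum1 mul1r.
  by rewrite subrr mul0r.
have sq b : 0 <= gain y k b * (J y k b - m).
  rewrite /gain -/m; have [d0|d0] := leP (J y k b - m) 0; first by rewrite mul0r.
  by rewrite mulr_ge0 // ltW.
move/eqP; rewrite psumr_eq0 // => /allP/(_ a (mem_index_enum a)) /=.
rewrite /gain -/m; have [//|d0] := leP (J y k a - m) 0.
by rewrite mulf_eq0 orbb gt_eqF.
Qed.

End NashMap.
Arguments decode {R G C} U0 y i t k.

Theorem theorem1 (R : realType) (G : game R) (C : compression G) :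
  rewards_bounded G -> actions_recalled G -> actions_nonempty G ->
  MSI C ->
  exists rho : kprofile C, K_BNE C rho.
Proof.
move=> _ _ nonempty msi.
have U0 t i : (0 < #|U G t i|)%N.
  by have [a _] := nonempty t i; apply/card_gt0P; exists a.
(* One constraint per player and full-history deviation: a point with all [phi d] at most 0 encodes
   an equilibrium. *)
pose phi (d : {i : Pl G & strat G i}) (y : {ptws agent_action C -> R}) : R :=
  payoff G (dfwith (kprofile_beh C (decode U0 y)) (projT2 d)) (projT1 d) -
  payoff G (kprofile_beh C (decode U0 y)) (projT1 d).
have cphi d : continuous (phi d).
  have cdec j t h u :
      continuous (fun y => kprofile_beh C (decode U0 y) j t h u).
    exact: decode_continuous.
  apply: continuous_subr; apply: payoff_continuous => //.
  by apply: dfwith_continuous => // t h u; apply: continuous_const.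
have [e e0|y _ yP] := compact_limit_le0 (@cube_compact R (agent_action C)) cphi.
  (* [B / n.+1%:R] is the error in [trembling_equilibrium]; this [n] makes it at most [e]. *)
  pose B : R := 2 * (T G)%:R ^+ 2; pose n := Num.truncn (B / e).
  have le_e : B / n.+1%:R <= e.
    by rewrite ler_pdivrMr ?ltr0n // mulrC -ler_pdivrMr // ltW // truncnS_gt.
  have [x /(trembling_equilibrium msi) opt] := one_shot_equilibrium C U0 n.
  set rho := tremble_profile U0 n x in opt.
  (* The point encodes the trembled profile [rho] rather than [x]; [decode] recovers it before the
     horizon, which is all that payoffs see. *)
  pose y : {ptws agent_action C -> R} := fun b =>
    rho (tag b) (tag (tagged b)) (tagged (tagged b)).1 (tagged (tagged b)).2.
  have dec j t k u : (t < T G)%N -> decode U0 y j t k u = rho j t k u.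
    move=> tT; have cy c : agent_weight y k c = rho j t k c by rewrite (agent_weightE y tT).
    rewrite -cy; apply: normalize_id => [c|]; first by rewrite cy dist_ge0.
    by rewrite -(dist_sum1 (rho j t k)); apply: eq_bigr => c _; apply: cy.
  exists y => [b|[i gi]] /=.
    by apply/andP; split; [apply: dist_ge0|apply: dist_le1].
  rewrite /phi /= lerBlDl; apply: le_trans (_ : _ <= payoff G (kprofile_beh C rho) i + e) _.
    apply: le_trans (_ : payoff G (dfwith (kprofile_beh C rho) gi) i <= _).
      rewrite le_eqVlt; apply/orP; left; apply/eqP/eq_payoff => j t h u tT.
      have [ij|ij] := eqVneq i j; first by subst j; rewrite !dfwith_in.
      by rewrite !dfwith_out //; apply: dec.
    by apply: le_trans (opt i gi) _; rewrite lerD2l.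
  rewrite lerD2r le_eqVlt; apply/orP; left; apply/eqP/eq_payoff => j t h u tT.
  by rewrite /kprofile_beh /kstrat_beh dec.
exists (decode U0 y) => i gi; rewrite -subr_le0.
exact: (yP (existT _ i gi)).
Qed.
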